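(* There is a function $\varepsilon:\mathbb{N}\to[0,\infty)$ with $\varepsilon(n)\to 0$ as $n\to\infty$ such that for all integers $1\le d\le n$ the following hold. (1) If $C'\subseteq\{0,1\}^n$ is a nonempty code with block length $n$ and dual distance $d$, then the essential covering radius $r$ of $C'$ satisfies $$r\le\frac n2-\sqrt{d(n-d)}+\varepsilon(n)\,n.$$ (2) In particular, if $C\subseteq\mathbb{F}_2^n$ is a linear code with block length $n$ and minimal distance $d$, then the essential covering radius $r$ of the dual code $C^{\perp}$ satisfies $$r\le\frac n2-\sqrt{d(n-d)}+\varepsilon(n)\,n.$$
   Context: The cube $\{0,1\}^n$ is identified with $\mathbb{F}_2^n$; $|S|$ denotes Hamming weight. A code with block length $n$ is a subset of $\{0,1\}^n$; it has minimal distance $d$ if the Hamming distance between any two of its distinct points is at least $d$. A linear code $C$ is a linear subspace of $\mathbb{F}_2^n$, and its dual code $C^{\perp}$ consists of all vectors orthogonal to $C$ over $\mathbb{F}_2$. For $f:\mathbb{F}_2^n\to\mathbb{R}$ the Fourier transform is $\widehat f(S)=2^{-n}\sum_{x\in\mathbb{F}_2^n}f(x)(-1)^{\langle x,S\rangle}$. A code $C'$ has dual distance $d$ if $\widehat{1_{C'}}(S)=0$ for all $S$ with $0<|S|<d$. The essential covering radius of a nonempty code $C'\subseteq\{0,1\}^n$ is the smallest integer $r\ge 0$ such that the union of the Hamming balls of radius $r$ centered at the points of $C'$ contains at least $2^n/n$ points of $\{0,1\}^n$. *)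

(* Defs.v *)
From HB Require Import structures.
From mathcomp Require Import all_boot all_order all_algebra reals.
Set Implicit Arguments.
Unset Strict Implicit.
Unset Printing Implicit Defensive.
Import Order.TTheory GRing.Theory Num.Theory.
Local Open Scope ring_scope.

Notation cube n := 'rV['F_2]_n.

Definition hweight n (x : cube n) : nat := #|[set i | x 0 i != 0]|.

Definition hdist n (x y : cube n) : nat := #|[set i | x 0 i != y 0 i]|.

(* As in the usual convention for bounds, this says that the minimum distance
   is at least d; codes with at most one point satisfy it for every d. *)
Definition has_min_distance n (C : {set cube n}) (d : nat) : Prop :=
  {in C &, forall x y, x != y -> (d <= hdist x y)%N}.

Definition dotF2 n (x y : cube n) : 'F_2 := \sum_i x 0 i * y 0 i.

Definition dual_code n (C : {vspace cube n}) : {set cube n} :=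
  [set y | [forall x, (x \in C) ==> (dotF2 x y == 0)]].

(* The exponent is the representative in {0, 1} of the element of 'F_2. *)
Definition fourier (R : realType) n (f : cube n -> R) (S : cube n) : R :=
  2 ^- n * \sum_x f x * (-1) ^+ nat_of_ord (dotF2 x S).

Definition has_dual_distance (R : realType) n (C : {set cube n}) (d : nat) :
  Prop :=
  forall S : cube n, (0 < hweight S < d)%N ->
    fourier (fun x => (x \in C)%:R : R) S = 0.

Definition ball_union n (C : {set cube n}) (r : nat) : {set cube n} :=
  \bigcup_(c in C) [set x | (hdist x c <= r)%N].

Definition essentially_covers n (C : {set cube n}) (r : nat) : bool :=
  2 ^+ n / n%:R <= #|ball_union C r|%:R :> rat.

Definition is_essential_covering_radius n (C : {set cube n}) (r : nat) : Prop :=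
  essentially_covers C r /\
  forall r' : nat, essentially_covers C r' -> (r <= r')%N.

Lemma essential_covering_radius_exists n (C : {set cube n}) :
  C != set0 -> exists r, is_essential_covering_radius C r.
Proof.
case/set0Pn=> c cC.
have nP : exists r, essentially_covers C r.
  exists n; rewrite /essentially_covers.
  have -> : ball_union C n = setT.
    apply/setP=> x; rewrite inE; apply/bigcupP; exists c => //.
    by rewrite inE (leq_trans (max_card _)) ?card_ord.
  rewrite cardsT card_mx card_Fp // mul1n natrX.
  case: n {C c cC} => [|n]; first by rewrite invr0 mulr0 ler01.
  by rewrite ler_pdivrMr ?ltr0n // ler_peMr ?exprn_ge0 ?ler1n.
case: (ex_minnP nP) => r rC rmin.
by exists r; split.
Qed.

Lemma essential_covering_radius_unique n (C : {set cube n}) r s :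
  is_essential_covering_radius C r -> is_essential_covering_radius C s -> r = s.
Proof.
case=> rC rmin [sC smin].
by apply/eqP; rewrite eqn_leq rmin ?smin.
Qed.

(* Main.v *)
(** If [f >= 0] lives on a Hamming ball [B] and its adjacency operator satisfies
    [A f >= lambda f], then the sum [F] of the translates of [f] by the points of
    [C'] lives on the union of the translates of [B] and satisfies
    [A F >= lambda F].  In the Fourier basis [A] is multiplication by
    [n - 2|S|], and [F] inherits from [C'] the vanishing of its coefficients for
    [0 < |S| < d].  Hence [lambda >= n - 2d + 2] forces a fixed proportion of the
    energy of [F] onto the coefficient at [0], and Cauchy-Schwarz bounds the
    support of [F] from below by [2^n / n] (Navon and Samorodnitsky).  A function
    with [lambda = 2 sqrt(k0 (n - k0)) - O(sqrt n)] on a ball of radius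
    [k0 + O(sqrt n)] is [t^|x|] times a parabola in [|x|]; taking [k0] at distance
    [O(n^(3/4))] above [n/2 - sqrt(d (n - d))] gives [eps n = O(n^(-1/4))]. *)
Require Import Defs.
From HB Require Import structures.
From mathcomp Require Import all_boot all_order all_algebra.
From mathcomp Require Import all_classical all_reals all_analysis.
From mathcomp Require Import ring lra zify.
Set Implicit Arguments.
Unset Strict Implicit.
Unset Printing Implicit Defensive.
Import Order.TTheory GRing.Theory Num.Theory.
Import numFieldNormedType.Exports.
Local Open Scope classical_set_scope.
Local Open Scope ring_scope.

(** * Arithmetic over ['F_2] and on the cube *)

Lemma signF2D (R : pzRingType) (a b : 'F_2) :
  (-1) ^+ nat_of_ord (a + b) = (-1) ^+ nat_of_ord a * (-1) ^+ nat_of_ord b :> R.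
Proof. by rewrite -exprD -signr_odd /= modn2 oddb signr_odd. Qed.

Lemma neq0F2 (a : 'F_2) : a != 0 -> a = 1.
Proof. by case: a => [[|[|[]]]] // i _; apply: val_inj. Qed.

Lemma addF2K (a : 'F_2) : a + a = 0.
Proof. by case: a => [[|[|[]]]] // i; apply: val_inj. Qed.

Lemma cubeDD n (x : cube n) : x + x = 0.
Proof. by apply/rowP => i; rewrite !mxE addF2K. Qed.

Lemma cubeDK n (x : cube n) : involutive (+%R x).
Proof. by move=> y; rewrite addrA cubeDD add0r. Qed.

Lemma dotF2C n (x y : cube n) : dotF2 x y = dotF2 y x.
Proof. by apply: eq_bigr => i _; rewrite mulrC. Qed.

Lemma dotF2Dl n (x y z : cube n) : dotF2 (x + y) z = dotF2 x z + dotF2 y z.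
Proof.
by rewrite -big_split; apply: eq_bigr => i _; rewrite mxE mulrDl.
Qed.

Lemma dotF2_delta n (i : 'I_n) (x : cube n) : dotF2 (delta_mx 0 i) x = x 0 i.
Proof.
rewrite /dotF2 (bigD1 i) //= big1 => [|j /negPf ji].
  by rewrite mxE !eqxx mul1r addr0.
by rewrite mxE ji mul0r.
Qed.

Lemma dotF20 n (x : cube n) : dotF2 x 0 = 0.
Proof. by apply: big1 => i _; rewrite mxE mulr0. Qed.

Lemma card_cube n : #|{: cube n}| = (2 ^ n)%N.
Proof. by rewrite card_mx card_Fp // mul1n. Qed.

(** Reindexing along [h] shows that the sum is its own negative. It serves for characters and for
    dual codes. *)
Lemma sum_sign_involution (R : numDomainType) (T : finType) (h : T -> T)
  (P : pred T) (u : T -> R) :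
  involutive h -> (forall x, P (h x) = P x) -> (forall x, u (h x) = - u x) ->
  \sum_(x | P x) u x = 0.
Proof.
move=> hK hP hu.
have : \sum_(x | P x) u x = - \sum_(x | P x) u x.
  rewrite [LHS](reindex_inj (inv_inj hK)) -sumrN.
  by apply: eq_big => [x|x _]; [rewrite hP|rewrite hu].
by move/eqP; rewrite -addr_eq0 -mulr2n mulrn_eq0 /= => /eqP.
Qed.

(** * Fourier analysis and the spectral covering argument *)

Section Fourier.
Variables (R : realType) (n : nat).
Implicit Types (f g : cube n -> R) (x y S : cube n).

Definition chi S x : R := (-1) ^+ nat_of_ord (dotF2 x S).

Lemma chiC S x : chi S x = chi x S.
Proof. by rewrite /chi dotF2C. Qed.

Lemma chiD S x y : chi S (x + y) = chi S x * chi S y.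
Proof. by rewrite /chi dotF2Dl signF2D. Qed.

Lemma sum_chi S : \sum_x chi S x = (S == 0)%:R * 2 ^+ n.
Proof.
have [->|] := eqVneq.
  under eq_bigr do rewrite /chi dotF20 expr0.
  by rewrite sumr_const card_cube mul1r natrX.
case/rV0Pn => i /neq0F2 Si; rewrite mul0r.
apply: (sum_sign_involution (cubeDK (delta_mx 0 i))) => // x.
by rewrite chiD {1}/chi dotF2_delta Si expr1 mulN1r.
Qed.

Lemma parseval f g :
  \sum_x f x * g x = 2 ^+ n * \sum_S fourier f S * fourier g S.
Proof.
have E S : fourier f S * fourier g S =
    2 ^- n * 2 ^- n * \sum_x \sum_y f x * g y * chi (x + y) S.
  rewrite /fourier mulrACA; congr (_ * _); rewrite big_distrlr.
  apply: eq_bigr => x _; apply: eq_bigr => y _.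
  by rewrite /= mulrACA chiC chiD.
under [in RHS]eq_bigr do rewrite E.
rewrite -mulr_sumr !mulrA divff ?mul1r ?expf_neq0 ?pnatr_eq0 //.
rewrite exchange_big mulr_sumr; apply: eq_bigr => x _.
rewrite exchange_big (bigD1 x) //= [X in _ + X]big1 => [|y yx].
  rewrite -mulr_sumr sum_chi cubeDD eqxx addr0 mul1r mulrCA.
  by rewrite mulVf ?mulr1 ?expf_neq0 ?pnatr_eq0.
rewrite -mulr_sumr sum_chi -(inj_eq (can_inj (cubeDK x))) cubeDK addr0.
by rewrite (negPf yx) mul0r mulr0.
Qed.

Definition adj f x : R := \sum_i f (x + delta_mx 0 i).

Lemma fourier_shift f y S :
  fourier (fun x => f (x + y)) S = chi S y * fourier f S.
Proof.
rewrite /fourier mulrCA; congr (_ * _).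
rewrite (reindex_inj (can_inj (cubeDK y))) mulr_sumr.
by apply: eq_bigr => x _; rewrite addrC cubeDK -/(chi _ _) chiD mulrCA.
Qed.

Lemma fourier_sum (I : finType) (P : pred I) (F : I -> cube n -> R) S :
  fourier (fun x => \sum_(i | P i) F i x) S = \sum_(i | P i) fourier (F i) S.
Proof.
rewrite /fourier -mulr_sumr exchange_big; congr (_ * _).
by apply: eq_bigr => x _; rewrite mulr_suml.
Qed.

(** Shifting by the [i]-th unit vector scales the coefficient at [S] by [-1] if [S 0 i != 0] and by
    [1] otherwise; these signs add up to the eigenvalue. *)
Lemma fourier_adj f S :
  fourier (adj f) S = (n%:R - 2 * (hweight S)%:R) * fourier f S.
Proof.
rewrite fourier_sum; under eq_bigr do rewrite fourier_shift.
rewrite -mulr_suml; congr (_ * _).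
have E i : chi S (delta_mx 0 i) = 1 - 2 * (S 0 i != 0)%:R.
  rewrite /chi dotF2_delta; have [->|/neq0F2 ->] := eqVneq.
    by rewrite expr0 mulr0 subr0.
  by rewrite expr1 mulr1; ring.
under eq_bigr do rewrite E.
rewrite sumrB sumr_const card_ord -mulr_sumr; congr (_ - _ * _).
rewrite -natr_sum /hweight -sum1_card [in RHS]big_mkcond; congr _%:R.
by apply: eq_bigr => i _; rewrite inE; case: ifP.
Qed.

(** Unnormalised convolution of [f] with the indicator of [C], as [x + c = x - c] here. *)
Definition translates (C : {set cube n}) f x : R := \sum_(c in C) f (x + c).

Lemma fourier_translates (C : {set cube n}) f S :
  fourier (translates C f) S =
  2 ^+ n * fourier (fun x => (x \in C)%:R) S * fourier f S.
Proof.
rewrite fourier_sum; under eq_bigr do rewrite fourier_shift.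
rewrite -mulr_suml; congr (_ * _).
rewrite /fourier mulVKf ?expf_neq0 ?pnatr_eq0 // big_mkcond.
by apply: eq_bigr => x _; case: ifP => _; rewrite ?mul1r ?mul0r.
Qed.

Lemma adj_translates (C : {set cube n}) f x :
  adj (translates C f) x = \sum_(c in C) adj f (x + c).
Proof.
by rewrite /adj exchange_big; do 2!apply: eq_bigr => ? _; rewrite addrAC.
Qed.

(** Cauchy-Schwarz: with [s] the sum of [f] and [q] that of its squares, the squares of [#|A| f - s]
    over [A] add up to [#|A| (#|A| q - s^2)]. *)
Lemma support_bound f (A : {set cube n}) :
  (forall x, x \notin A -> f x = 0) ->
  (\sum_x f x) ^+ 2 <= #|A|%:R * \sum_x f x ^+ 2.
Proof.
move=> fA.
have sA (u : cube n -> R) : (forall x, x \notin A -> u x = 0) ->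
    \sum_x u x = \sum_(x in A) u x.
  move=> uA; rewrite [RHS]big_mkcond; apply: eq_bigr => x _.
  by case: ifPn => // /uA.
rewrite sA // [X in _ <= _ * X]sA => [|x /fA ->]; last by rewrite expr0n.
have sqE a b : \sum_(x in A) (a * f x - b) ^+ 2 =
    a ^+ 2 * (\sum_(x in A) f x ^+ 2) - 2 * a * b * (\sum_(x in A) f x)
    + b ^+ 2 *+ #|A|.
  rewrite -sumr_const !mulr_sumr -sumrB -big_split.
  by apply: eq_bigr => x _ /=; ring.
set s := \sum_(x in A) f x; set q := \sum_(x in A) _.
have : 0 <= \sum_(x in A) (#|A|%:R * f x - s) ^+ 2.
  by apply: sumr_ge0 => x _; apply: sqr_ge0.
rewrite sqE -/s -/q => H.
have [A0|A0] := posnP #|A|.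
  rewrite A0 mul0r /s big_pred0 ?expr0n // => x.
  by rewrite (cards0_eq A0) inE.
have A0R : 0 < #|A|%:R :> R by rewrite ltr0n.
rewrite -(ler_pM2l A0R) -subr_ge0; by move: H; congr (0 <= _); ring.
Qed.

Lemma spectral_cover (C A : {set cube n}) (d : nat) (lam : R) f :
  (d <= n)%N -> has_dual_distance R C d ->
  (forall x, 0 <= f x) ->
  (forall x, lam * f x <= adj f x) ->
  n%:R - 2 * d%:R + 2 <= lam ->
  (forall x, x \notin A -> translates C f x = 0) ->
  (exists x, translates C f x != 0) ->
  (2 ^ n <= #|A| * n)%N.
Proof.
move=> dn Cd f0 flam lamd FA [x0 Fx0].
set F := translates C f in FA Fx0.
have F0 x : 0 <= F x by apply: sumr_ge0.
have FAF : lam * \sum_x F x ^+ 2 <= \sum_x F x * adj F x.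
  rewrite mulr_sumr; apply: ler_sum => x _.
  rewrite expr2 mulrCA ler_wpM2l // adj_translates mulr_sumr.
  exact: ler_sum.
have Q0 : 0 < \sum_x F x ^+ 2.
  rewrite (bigD1 x0) //= ltr_pwDl ?exprn_even_gt0 //.
  by apply: sumr_ge0 => x _; apply: sqr_ge0.
have EQ : \sum_x F x ^+ 2 = 2 ^+ n * \sum_S fourier F S ^+ 2.
  by rewrite -parseval.
have E2n : 0 < 2 ^+ n :> R by rewrite exprn_gt0.
have FS0 S : S != 0 -> (hweight S < d)%N -> fourier F S = 0.
  move=> /rV0Pn[i Si] Sd; rewrite fourier_translates Cd ?mulr0 ?mul0r //.
  by rewrite Sd andbT card_gt0; apply/set0Pn; exists i; rewrite inE.
(* The eigenvalue at [0] is [n], which exceeds [n - 2d] by [2d]; the other surviving ones are at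
   most [n - 2d]. As [lam] exceeds [n - 2d] by at least [2], twice the energy is at most [2d] times
   the share of [0]. *)
have key : \sum_x F x ^+ 2 <= 2 ^+ n * (d%:R * fourier F 0 ^+ 2).
  have : \sum_x F x * adj F x <=
      2 ^+ n * (2 * d%:R * fourier F 0 ^+ 2) +
      (n%:R - 2 * d%:R) * \sum_x F x ^+ 2.
    rewrite parseval EQ [X in _ + X]mulrCA -mulrDr ler_pM2l //.
    rewrite (bigD1 0) //= [in X in _ <= X](bigD1 0) //= mulrDr addrA.
    apply: lerD.
      rewrite fourier_adj /hweight; set w := #|_|.
      have -> : w = 0%N.
        apply/eqP; rewrite cards_eq0; apply/eqP/setP => i.
        by rewrite !inE mxE eqxx.
      by rewrite le_eqVlt; apply/orP; left; apply/eqP; ring.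
    rewrite mulr_sumr; apply: ler_sum => S S0.
    rewrite fourier_adj mulrCA -expr2.
    have [/FS0 -> //|dS] := ltnP (hweight S) d; first by rewrite expr0n !mulr0.
    rewrite ler_wpM2r ?sqr_ge0 // lerD2l lerN2 ler_pM2l ?ltr0n //.
    by rewrite ler_nat.
  nra.
have := support_bound FA.
have -> : \sum_x F x = 2 ^+ n * fourier F 0.
  rewrite /fourier mulVKf ?gt_eqF //; apply: eq_bigr => x _.
  by rewrite dotF20 mulr1.
move=> sb; rewrite -(ler_nat R) natrX natrM -(ler_pM2r Q0).
apply: (@le_trans _ _ (n%:R * (2 ^+ n * fourier F 0) ^+ 2)); last first.
  by rewrite [_ * n%:R]mulrC -mulrA ler_wpM2l.
rewrite exprMn [2 ^+ n ^+ 2]expr2 mulrCA -[X in _ <= X]mulrA ler_pM2l //.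
apply: (le_trans key).
by rewrite ler_wpM2l ?exprn_ge0 // ler_wpM2r ?sqr_ge0 // ler_nat.
Qed.

End Fourier.

(** * Hamming weight and coordinate flips *)

Lemma hweight_le n (x : cube n) : (hweight x <= n)%N.
Proof. by rewrite (leq_trans (max_card _)) ?card_ord. Qed.

Lemma hdistE n (x y : cube n) : hdist x y = hweight (x + y).
Proof.
apply: eq_card => i; rewrite !inE mxE -subr_eq0.
by rewrite (_ : - y 0 i = y 0 i) //; apply/eqP; rewrite eq_sym -addr_eq0 addF2K.
Qed.

Lemma hweight_flip n (x : cube n) (i : 'I_n) :
  hweight (x + delta_mx 0 i) =
  if x 0 i != 0 then (hweight x).-1 else (hweight x).+1.
Proof.
have E : [set j | (x + delta_mx 0 i) 0 j != 0]%SET =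
    if x 0 i != 0 then [set j | x 0 j != 0]%SET :\ i
    else i |: [set j | x 0 j != 0]%SET.
  apply/setP => j; case: ifPn => [/neq0F2|/negPn/eqP] xi.
    by rewrite !inE !mxE eqxx /=; have [->|] := eqVneq j i; rewrite ?xi ?addr0.
  by rewrite !inE !mxE eqxx /=; have [->|] := eqVneq j i; rewrite ?xi ?addr0.
rewrite /hweight E; case: ifPn => xi; last by rewrite cardsU1 inE (negPf xi).
by rewrite [in RHS](cardsD1 i) inE xi.
Qed.

Lemma exists_hweight n w : (w <= n)%N -> exists x : cube n, hweight x = w.
Proof.
elim: w => [|w IHw] wn.
  by exists 0; apply: eq_card0 => i; rewrite !inE mxE eqxx.
have [x xw] := IHw (ltnW wn).
have [i xi] : exists i, x 0 i == 0.
  apply/existsP; move: wn; apply: contraLR => /existsPn xN0.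
  rewrite -ltnNge ltnS -xw /hweight (_ : [set i | _]%SET = finset.setT).
    by rewrite cardsT card_ord.
  by apply/setP => i; rewrite !inE xN0.
by exists (x + delta_mx 0 i); rewrite hweight_flip xi xw.
Qed.

(** * Radial functions and the test function on a ball *)

Section Radial.
Variables (R : realType) (n : nat).

Lemma adj_radial (g : nat -> R) (x : cube n) :
  adj (fun y => g (hweight y)) x =
  (hweight x)%:R * g (hweight x).-1 + (n - hweight x)%:R * g (hweight x).+1.
Proof.
rewrite /adj (bigID (fun i => x 0 i != 0)) /=; congr (_ + _).
  under eq_bigr => i xi do rewrite hweight_flip xi.
  by rewrite sumr_const mulr_natl /hweight cardsE.
under eq_bigr => i xi do rewrite hweight_flip (negPf xi).
rewrite sumr_const mulr_natl; congr (_ *+ _).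
have := cardsC [set i | x 0 i != 0]%SET; rewrite card_ord /hweight.
set A := [set i | _]%SET => cA; rewrite -[X in (X - _)%N]cA addKn.
by apply: eq_card => i; rewrite !inE.
Qed.

Variables (k0 m : nat) (t : R).

(* The parabola [h j = j (m + 1 - j)] satisfies [h (j-1) + h (j+1) = 2 h j - 2]
   with [m <= h j] in the window, hence the factor [1 - 1/m] below; the weight
   [t^k] with [t = sqrt (k0 / (n - k0))] equalizes the two coefficients
   [k0 / t = (n - k0) t = sqrt (k0 (n - k0))]. *)
Definition bump_weight (k : nat) : R :=
  if (k0 <= k <= k0 + m.+1)%N
  then t ^+ k * (k%:R - k0%:R) * (k0%:R + m.+1%:R - k%:R)
  else 0.

Lemma bump_weight_ge0 k : 0 <= t -> 0 <= bump_weight k.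
Proof.
move=> t0; rewrite /bump_weight; case: ifP => // /andP[k1 k2].
by rewrite !mulr_ge0 ?exprn_ge0 // subr_ge0 -?natrD ler_nat.
Qed.

Lemma bump_weight_eq0 k : (k0 + m < k)%N -> bump_weight k = 0.
Proof.
move=> k1; rewrite /bump_weight; case: ifP => // /andP[_ k2].
have -> : k = (k0 + m.+1)%N by lia.
by rewrite natrD subrr mulr0.
Qed.

(** The hypotheses on [s] say [(n - k0) t = s = k0 / t]. Replacing [k] by [k0] only lowers the right
    side; replacing [n - k] by [n - k0] has an error controlled by [(k - k0) t <= m + 1], paid for
    by the term [2 (m + 1)]. *)
Lemma bump_weight_recurrence (s : R) k :
  (0 < m)%N -> (k <= n)%N -> 0 < t <= 1 ->
  s = n%:R * t - k0%:R * t -> k0%:R = s * t ->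
  (2 * s * (1 - m%:R^-1) - 2 * m.+1%:R) * bump_weight k <=
  k%:R * bump_weight k.-1 + (n - k)%:R * bump_weight k.+1.
Proof.
move=> m0 kn /andP[t0 t1] sE k0E.
have rhs0 : 0 <= k%:R * bump_weight k.-1 + (n - k)%:R * bump_weight k.+1.
  by have t0' := ltW t0; rewrite addr_ge0 ?mulr_ge0 ?bump_weight_ge0.
(* Off the open window the weight is zero, also at both endpoints, where a factor of the parabola
   vanishes; then [rhs0] suffices. *)
have [/andP[k1 k2]|out] := boolP (k0 < k < k0 + m.+1)%N; last first.
  rewrite [bump_weight k](_ : _ = 0) ?mulr0 //.
  rewrite /bump_weight; case: ifP => // /andP[k1 k2].
  have [->|->] : k = k0 \/ k = (k0 + m.+1)%N by lia.
    by rewrite subrr mulr0 mul0r.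
  by rewrite natrD subrr mulr0.
have [j [Ek jm]] : exists j, k = (k0 + j.+1)%N /\ (j < m)%N.
  by exists (k - k0)%N.-1; lia.
rewrite {}Ek in kn rhs0 k1 k2 *.
have s0 : 0 <= s by rewrite -(pmulr_lge0 _ t0) -k0E.
have in1 : (k0 <= k0 + j.+1 <= k0 + m.+1)%N by lia.
have in2 : (k0 <= (k0 + j.+1).-1 <= k0 + m.+1)%N by lia.
have in3 : (k0 <= (k0 + j.+1).+1 <= k0 + m.+1)%N by lia.
rewrite /bump_weight in1 in2 in3 natrB // !addnS /= !exprS -!natr1 !natrD.
set T := t ^+ (k0 + j).
have T0 : 0 <= T by rewrite exprn_ge0 // ltW.
have a0 : 0 <= j%:R :> R by [].
have am : j%:R + 1 <= m%:R :> R by rewrite natr1 ler_nat.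
move: a0 am; set a := j%:R; set b := m%:R => a0 ab.
clearbody T a b.
pose h := (a + 1) * (b - a).
(* Two numbers at least [1] with sum [b + 1] have product at least [b]. *)
have hb : b <= h by rewrite /h; nra.
have bV : b * b^-1 = 1 by rewrite divff //; lra.
have core : (2 * s * (1 - b^-1) - 2 * (b + 1)) * h <=
    s * (a * (b + 1 - a)) + (s - (a + 1) * t) * ((a + 2) * (b - a - 1)).
  have hV : 1 <= b^-1 * h.
    by rewrite -(@mulVf _ b) ?ler_wpM2l ?invr_ge0 //; lra.
  have X0 : 0 <= (a + 2) * (b - a - 1) by apply: mulr_ge0; lra.
  have Xh : (a + 2) * (b - a - 1) <= 2 * h by rewrite /h; nra.
  have at0 : 0 <= (a + 1) * t <= b + 1 by apply/andP; split; nra.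
  have loss : (a + 1) * t * ((a + 2) * (b - a - 1)) <= (b + 1) * (2 * h).
    by apply: ler_pM => //; case/andP: at0.
  have gain : s <= s * (b^-1 * h) by rewrite ler_peMr.
  rewrite -subr_ge0 [leRHS](_ : _ = 2 * (s * (b^-1 * h) - s) +
    ((b + 1) * (2 * h) - (a + 1) * t * ((a + 2) * (b - a - 1)))).
    by apply: addr_ge0; lra.
  by rewrite /h; ring.
(* The last two summands are zero by [k0E] and [sE]; writing them out leaves an identity for
   [ring]. *)
rewrite -subr_ge0 [leRHS](_ : _ = t * T *
    (s * (a * (b + 1 - a)) + (s - (a + 1) * t) * ((a + 2) * (b - a - 1))
     - (2 * s * (1 - b^-1) - 2 * (b + 1)) * h)
   + T * (a + 1) * a * (b + 1 - a)
   + (k0%:R - s * t) * T * a * (b + 1 - a)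
   + (n%:R * t - k0%:R * t - s) * t * T * (a + 2) * (b - a - 1)); last first.
  by rewrite /h; ring.
rewrite -sE k0E !subrr !mul0r !addr0.
by apply: addr_ge0; rewrite !mulr_ge0 ?subr_ge0 //; lra.
Qed.

End Radial.

(** * Covering criteria *)

Lemma essentially_coversP n (C : {set cube n}) r :
  (0 < n)%N -> (2 ^ n <= #|ball_union C r| * n)%N -> essentially_covers C r.
Proof.
move=> n0 H; rewrite /essentially_covers ler_pdivrMr ?ltr0n //.
by rewrite -natrX -natrM ler_nat.
Qed.

(** [spectral_cover] applies to the radial bump with [t = sqrt (k0 / (n - k0))], where [2 * k0 <= n]
    gives [t <= 1]. The radius is [k0 + m] because the bump already vanishes at [k0 + m + 1]. *)
Lemma cover_of_gap (R : realType) n (C : {set cube n}) d k0 m :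
  C != finset.set0 -> has_dual_distance R C d -> (d <= n)%N ->
  (0 < k0)%N -> (2 * k0 <= n)%N -> (0 < m)%N ->
  n%:R - 2 * d%:R + 2 <=
    2 * Num.sqrt (k0%:R * (n%:R - k0%:R)) * (1 - m%:R^-1) - 2 * m.+1%:R :> R ->
  essentially_covers C (k0 + m).
Proof.
move=> /set0Pn[c cC] Cd dn k00 k0n m0 gap.
apply: essentially_coversP; first by lia.
set s := Num.sqrt _ in gap.
have kR0 : 0 < k0%:R :> R by rewrite ltr0n.
have kRn : 2 * k0%:R <= n%:R :> R by rewrite -natrM ler_nat.
have s2 : s ^+ 2 = k0%:R * (n%:R - k0%:R) by rewrite sqr_sqrtr // mulr_ge0; lra.
have nk0 : 0 < n%:R - k0%:R :> R by lra.
have s0 : 0 < s by rewrite sqrtr_gt0 mulr_gt0.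
pose t := s / (n%:R - k0%:R).
have t0 : 0 < t by rewrite divr_gt0.
have t1 : t <= 1 by rewrite ler_pdivrMr // mul1r; nra.
have st : s = n%:R * t - k0%:R * t by rewrite -mulrBl mulrC divfK ?gt_eqF.
have k0E : k0%:R = s * t by rewrite /t mulrA -expr2 s2 mulfK ?gt_eqF.
have g0 k : 0 <= bump_weight k0 m t k by rewrite bump_weight_ge0 // ltW.
apply: (@spectral_cover _ _ C _ d _
  (fun x => bump_weight k0 m t (hweight x)) dn Cd _ _ gap) => //.
- move=> x; rewrite adj_radial; apply: bump_weight_recurrence => //.
  + exact: hweight_le.
  + by rewrite t0.
- move=> x xB; apply: big1 => c' c'C; apply: bump_weight_eq0.
  rewrite ltnNge; apply: contra xB => xc; apply/bigcupP; exists c' => //.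
  by rewrite inE hdistE.
(* [k0 + 1] is the least weight at which the bump is positive. *)
have [|v vk] := @exists_hweight n k0.+1; first by lia.
exists (v + c); rewrite gt_eqF // /translates (bigD1 c) //=.
rewrite ltr_pwDl ?sumr_ge0 // -addrA cubeDD addr0 vk /bump_weight.
have -> : (k0 <= k0.+1 <= k0 + m.+1)%N by lia.
rewrite !mulr_gt0 ?exprn_gt0 // subr_gt0 ?ltr_nat //.
by rewrite -natrD ltr_nat; lia.
Qed.

(** The distances of a point and of its complement to [c] add up to [n], so one of them is at most
    [n / 2]: the ball holds at least half of the cube. *)
Lemma cover_half n (C : {set cube n}) :
  C != finset.set0 -> (1 < n)%N -> essentially_covers C n./2.
Proof.
move=> /set0Pn[c cC] n1; apply: essentially_coversP; first by lia.
set B := ball_union C _.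
suff: (2 ^ n <= #|B| * 2)%N.
  by move=> H; apply: (leq_trans H); rewrite leq_mul2l n1 orbT.
pose h (x : cube n) : cube n := x + const_mx 1.
have hw (x : cube n) : (hweight x + hweight (h x) = n)%N.
  have := cardsC [set i | x 0 i != 0]%SET; rewrite card_ord => E.
  rewrite -[in RHS]E; congr (_ + _)%N; apply: eq_card => i.
  rewrite !inE !mxE negbK; have [->|/neq0F2 ->] := eqVneq (x 0 i) 0.
    by rewrite add0r.
  by rewrite addF2K eqxx.
have cover : finset.setT \subset B :|: [set h x | x in B]%SET.
  apply/fintype.subsetP => x _; rewrite inE.
  have inB y : (hweight (y + c) <= n./2)%N -> y \in B.
    by move=> yc; apply/bigcupP; exists c => //; rewrite inE hdistE.
  have := hw (x + c); have [xc _|xc E] := leqP (hweight (x + c)) n./2.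
    by rewrite inB.
  apply/orP; right; apply/imsetP; exists (h x); last first.
    by rewrite /h -addrA cubeDD addr0.
  by apply: inB; rewrite (_ : h x + c = h (x + c)); [lia|rewrite /h addrAC].
have := subset_leq_card cover; rewrite cardsT card_cube => H.
apply: (leq_trans H); rewrite muln2 -addnn (leq_trans (leq_card_setU _ _)) //.
by rewrite leq_add2l leq_imset_card.
Qed.

Lemma cover_full n (C : {set cube n}) :
  C != finset.set0 -> (0 < n)%N -> essentially_covers C n.
Proof.
move=> /set0Pn[c cC] n0; apply: essentially_coversP => //.
rewrite (_ : ball_union C n = finset.setT) ?cardsT ?card_cube ?leq_pmulr //.
apply/setP => x; rewrite inE; apply/bigcupP; exists c => //.
by rewrite inE hdistE hweight_le.
Qed.

(** * Real estimates *)

(** Here [p] is the fourth root of [n], so that only polynomials occur. The order [p^2] of [m]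
    balances the losses [2 s / m] and [2 m]. *)
Lemma gap_estimate (R : realFieldType) (p d b k s m : R) :
  1 <= p -> 0 <= d -> 0 <= b -> b ^+ 2 = d * (p ^+ 4 - d) ->
  p ^+ 4 / 2 - b + 6 * p ^+ 3 <= k <= p ^+ 4 / 2 ->
  0 <= s -> s ^+ 2 = k * (p ^+ 4 - k) ->
  p ^+ 2 <= m <= p ^+ 2 + 1 ->
  p ^+ 4 - 2 * d + 2 <= 2 * s * (1 - m^-1) - 2 * (m + 1).
Proof.
move=> p1 d0 b0 bE /andP[k1 k2] s0 sE /andP[m1 m2].
have q1 : 1 <= p ^+ 2 by rewrite exprn_ege1.
have c1 : 1 <= p ^+ 3 by rewrite exprn_ege1.
have le_of_sqr (x y : R) : 0 <= y -> x ^+ 2 <= y ^+ 2 -> x <= y.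
  move=> y0; apply: contraTT; rewrite -!ltNge => yx.
  by rewrite ltr_sqr ?nnegrE //; lra.
have sN : 2 * s <= p ^+ 4.
  apply: le_of_sqr; first by rewrite exprn_ge0 //; lra.
  rewrite exprMn sE -subr_ge0 (_ : _ - _ = (p ^+ 4 - 2 * k) ^+ 2) ?sqr_ge0 //.
  by ring.
(* With [n = p^4], both [s^2 + (n/2 - k)^2] and [b^2 + (n/2 - d)^2] equal [n^2/4], so
   [s^2 >= (n/2 - d)^2 + 12 b p^3 - 36 p^6]. As [b >= 6 p^3], the surplus is at least [36 p^6],
   while [10 p^2 (n/2 - d) + 25 p^4 <= 30 p^6] is needed. *)
have sd : p ^+ 4 / 2 - d + 5 * p ^+ 2 <= s.
  apply: le_of_sqr => //; rewrite sE.
  have u2 : (p ^+ 4 / 2 - k) ^+ 2 <= (b - 6 * p ^+ 3) ^+ 2.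
    by rewrite ler_sqr ?nnegrE; lra.
  have bp : 6 * p ^+ 3 * p ^+ 3 <= b * p ^+ 3 by rewrite ler_pM2r; lra.
  have c2 : p ^+ 3 * p ^+ 3 = p ^+ 2 * p ^+ 2 * p ^+ 2 by ring.
  have q2 : p ^+ 4 = p ^+ 2 * p ^+ 2 by ring.
  have qd : 0 <= p ^+ 2 * d by rewrite mulr_ge0 // exprn_ge0 //; lra.
  have q3 : p ^+ 2 * p ^+ 2 <= p ^+ 2 * p ^+ 2 * p ^+ 2.
    by rewrite ler_peMr // -expr2 sqr_ge0.
  move: u2 bE bp qd q3 c2; rewrite q2; move: (p ^+ 2) (p ^+ 3) => q c.
  nra.
have m0 : 0 < m by lra.
have sm : 2 * s * m^-1 <= p ^+ 2.
  rewrite ler_pdivrMr //; apply: (le_trans sN).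
  by rewrite (_ : p ^+ 4 = p ^+ 2 * p ^+ 2); [rewrite ler_pM2l //; lra|ring].
(* The [10 p^2] gained in [2 s] pays for [2 s / m <= p^2], for [2 (m + 1) <= 2 p^2 + 4] and for the
   required [2]. *)
lra.
Qed.

(** * Dual codes *)

(** A nonzero [S] of weight below [d] is not in [C], so some [y] orthogonal to [C] has
    [dotF2 y S = 1]; translation by [y] preserves the dual code and flips the sign of the
    character. *)
Lemma dual_distance_dual_code (R : realType) n (C : {vspace cube n}) d :
  has_min_distance [set x in C]%SET d -> has_dual_distance R (dual_code C) d.
Proof.
move=> Cd S /andP[S0 Sd].
have SC : S \notin C.
  apply: contraL Sd => SC; rewrite -leqNgt -[S]addr0 -hdistE.
  apply: Cd; rewrite ?inE ?mem0v //; apply: contraTneq S0 => ->.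
  by rewrite -leqNgt leqn0 cards_eq0; apply/eqP/setP => i; rewrite !inE mxE eqxx.
have [i wi] : exists i, (S - projv C S) 0 i != 0.
  apply/rV0Pn; apply: contraNneq SC => /eqP; rewrite subr_eq0 => /eqP ->.
  exact: memv_proj.
(* This linear form vanishes on [C] but not at [S]; [y] represents it. *)
pose phi (v : cube n) := (v - projv C v) 0 i.
pose y : cube n := \row_j phi (delta_mx 0 j).
have phiE v : dotF2 v y = phi v.
  rewrite /phi [in RHS](row_sum_delta v) linear_sum -sumrB summxE.
  apply: eq_bigr => j _; rewrite linearZ -scalerBr !mxE.
  by rewrite /phi !mxE.
have yC x : x \in C -> dotF2 x y = 0.
  by move=> xC; rewrite phiE /phi projv_id // subrr mxE.
rewrite /fourier (_ : \sum_x _ = 0) ?mulr0 //.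
apply: (sum_sign_involution (cubeDK y)) => // x.
rewrite -!/(chi R _ _) chiD /chi [dotF2 y S]dotF2C phiE /phi (neq0F2 wi) expr1.
rewrite (_ : (y + x \in _) = (x \in dual_code C)).
  by rewrite mulN1r mulrN.
rewrite !inE; apply: eq_forallb => z; apply: implyb_id2l => /yC zy.
by rewrite dotF2C dotF2Dl [dotF2 y z]dotF2C zy add0r dotF2C.
Qed.

Lemma dual_code_neq0 n (C : {vspace cube n}) : dual_code C != finset.set0.
Proof.
apply/set0Pn; exists 0; rewrite inE.
by apply/forallP => x; rewrite dotF20 eqxx implybT.
Qed.

(** * Choice of parameters and the limit *)

Lemma covering_radius_bound (R : realType) n d (C : {set cube n}) r :
  (1 <= d <= n)%N -> C != finset.set0 -> has_dual_distance R C d ->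
  is_essential_covering_radius C r ->
  r%:R <= n%:R / 2 - Num.sqrt (d%:R * (n%:R - d%:R)) +
          10 / Num.sqrt (Num.sqrt n%:R) * n%:R :> R.
Proof.
move=> /andP[d1 dn] C0 Cd [_ rmin].
have n1 : (1 <= n)%N by apply: leq_trans dn.
have nR1 : 1 <= n%:R :> R by rewrite ler1n.
have dR : d%:R <= n%:R :> R by rewrite ler_nat.
set q := Num.sqrt n%:R; set p := Num.sqrt q; set b := Num.sqrt (d%:R * _).
have q1 : 1 <= q by rewrite -sqrtr1 ler_wsqrtr.
have p1 : 1 <= p by rewrite -[leLHS]sqrtr1 ler_wsqrtr.
have q2 : q ^+ 2 = n%:R by rewrite sqr_sqrtr.
have p2 : p ^+ 2 = q by rewrite sqr_sqrtr // sqrtr_ge0.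
have p4 : p ^+ 4 = n%:R by rewrite -q2 -p2; ring.
have b0 : 0 <= b := sqrtr_ge0 _.
have bE : b ^+ 2 = d%:R * (n%:R - d%:R) by rewrite sqr_sqrtr // mulr_ge0 // subr_ge0.
have -> : 10 / p * n%:R = 10 * p ^+ 3 by rewrite -p4; field; lra.
have c1 : 1 <= p ^+ 3 by rewrite exprn_ege1.
have qc : q <= p ^+ 3 by rewrite -p2 [leRHS]exprS ler_peMl // exprn_ge0 //; lra.
have rN k : essentially_covers C k -> r%:R <= k%:R :> R by move=> /rmin; rewrite ler_nat.
have b_half : b <= n%:R / 2.
  have : 0 <= (n%:R / 2 - d%:R) ^+ 2 :> R by apply: sqr_ge0.
  have [//|] := leP b (n%:R / 2); nra.
(* If [b <= 6 p^3 + 1], the claimed bound is at least [n / 2] and [cover_half] suffices; for [n = 1]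
   the threshold [2^n / n] is the whole cube, hence radius [n]. *)
have [small|large] := leP (n%:R / 2) (n%:R / 2 - b + 6 * p ^+ 3 + 1).
  have [n_gt1|n_le1] := ltnP 1 n.
    have := rN _ (cover_half C0 n_gt1).
    have : n./2%:R * 2 <= n%:R :> R by rewrite -natrM ler_nat; lia.
    lra.
  have := rN _ (cover_full C0 n1).
  have : n%:R <= 1 :> R by rewrite lern1.
  lra.
have y0 : 0 <= n%:R / 2 - b + 6 * p ^+ 3 by lra.
(* Truncation plus one makes both integers positive and costs at most [1] each; the total excess
   [6 p^3 + q + 2] over [n/2 - b] stays within [10 p^3]. *)
pose k0 := (Num.truncn (n%:R / 2 - b + 6 * p ^+ 3)).+1.
pose m := (Num.truncn q).+1.
have [k1 k2] : n%:R / 2 - b + 6 * p ^+ 3 <= k0%:R /\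
    k0%:R <= n%:R / 2 - b + 6 * p ^+ 3 + 1.
  have /andP[l u] := truncn_itv y0; split; first exact: ltW u.
  by rewrite -[leLHS]natr1 lerD2r.
have [m1 m2] : q <= m%:R /\ m%:R <= q + 1.
  have /andP[l u] := truncn_itv (ltW (lt_le_trans ltr01 q1)); split; first exact: ltW u.
  by rewrite -[leLHS]natr1 lerD2r.
have cov : essentially_covers C (k0 + m).
  apply: (@cover_of_gap R _ _ d) => //.
    by rewrite -(ler_nat R) natrM; lra.
  rewrite -[m.+1%:R]natr1 -p4; apply: (@gap_estimate _ p _ b k0%:R) => //.
  - by rewrite p4.
  - by rewrite p4 k1; lra.
  - by rewrite sqr_sqrtr // p4 mulr_ge0 //; lra.
  - by rewrite p2 m1.
by have := rN _ cov; rewrite natrD; lra.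
Qed.

Lemma cvg_inv_fourth_root (R : realType) :
  (10 / Num.sqrt (Num.sqrt n%:R) : R) @[n --> \oo] --> (0 : R).
Proof.
apply/cvgrPdist_le => e e0; near=> n.
have h : (10 / e) ^+ 4 <= n%:R by near: n; apply: nbhs_infty_ger.
have x0 : 0 < 10 / e by rewrite divr_gt0.
have : 10 / e <= Num.sqrt (Num.sqrt n%:R).
  rewrite -[10 / e]gtr0_norm // -sqrtr_sqr ler_wsqrtr //.
  rewrite -[_ ^+ 2]ger0_norm ?sqr_ge0 // -sqrtr_sqr ler_wsqrtr //.
  by rewrite -exprM.
move=> pe; have p0 := lt_le_trans x0 pe.
rewrite sub0r normrN ger0_norm ?divr_ge0 ?sqrtr_ge0 //.
by rewrite ler_pdivrMr // mulrC -ler_pdivrMr.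
Unshelve. all: by end_near. Qed.

Theorem corollary1p5 (R : realType) :
  exists eps : nat -> R,
    [/\ forall n : nat, 0 <= eps n,
        eps n @[n --> \oo] --> (0 : R)
      & forall n d : nat, (1 <= d <= n)%N ->
          (forall (C' : {set cube n}) (r : nat),
             C' != finset.set0 ->
             has_dual_distance R C' d ->
             is_essential_covering_radius C' r ->
             r%:R <= n%:R / 2 - Num.sqrt (d%:R * (n%:R - d%:R)) + eps n * n%:R)
          /\
          (forall (C : {vspace cube n}) (r : nat),
             has_min_distance [set x in C]%SET d ->
             is_essential_covering_radius (dual_code C) r ->
             r%:R <= n%:R / 2 - Num.sqrt (d%:R * (n%:R - d%:R))
                     + eps n * n%:R)].
Proof.
exists (fun n => 10 / Num.sqrt (Num.sqrt n%:R)); split.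
- by move=> n; rewrite divr_ge0 ?sqrtr_ge0.
- exact: cvg_inv_fourth_root.
- move=> n d dn; split=> [C' r|C r Cd]; first exact: covering_radius_bound.
  exact: covering_radius_bound dn (dual_code_neq0 C) (dual_distance_dual_code R Cd).
Qed.
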